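(* For a finite simple graph $G$ the following statements are equivalent: (1) $G$ admits a $\{{}^bP_3,{}^rP_3,{}^bK_3\}$-free $2$-edge-colouring. (2) $G$ admits a $\{{}^bP_3,{}^rP_3,{}^rK_3\}$-free $2$-edge-colouring. (3) $G$ admits a $\{{}^bP_3,{}^rP_3,{}^bK_3,{}^{rrb}K_3\}$-free $2$-edge-colouring. (4) $G$ admits a $\{{}^bP_3,{}^rP_3,{}^rK_3,{}^{rbb}K_3\}$-free $2$-edge-colouring. (5) $G$ is an $X$-augmentation of the line graph of an incidence multigraph $H(X,Y)$. (6) $G$ is an $X$-augmentation of the line graph of an incidence graph $H(X,Y)$.
   Context: Graphs are finite and simple unless called multigraphs (which may have parallel edges, no loops). A $2$-edge-colouring of $G$ assigns to every edge the colour red or blue (not necessarily properly). For a set $\mathcal F$ of $2$-edge-coloured graphs, a $2$-edge-colouring of $G$ is $\mathcal F$-free if no induced $2$-edge-coloured subgraph is isomorphic (preserving colours) to a member of $\mathcal F$. Patterns on three vertices: ${}^rP_3$ (resp. ${}^bP_3$) is the path on three vertices with both edges red (resp. blue); ${}^rK_3$ (resp. ${}^bK_3$) is the triangle with all edges red (resp. blue); ${}^{rrb}K_3$ is the triangle with two red and one blue edge; ${}^{rbb}K_3$ is the triangle with one red and two blue edges. The line graph of a (multi)graph $H$ is the simple graph with vertex set $E(H)$, two distinct edges being adjacent iff they share at least one endpoint (so parallel edges are adjacent). An incidence graph $H(X,Y)$ is a bipartite graph with bipartition $(X,Y)$ in which every $x\in X$ has degree at most $2$. An incidence multigraph $H(X,Y)$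 is a bipartite multigraph with bipartition $(X,Y)$ in which $|N(x)|\le 2$ for every $x\in X$ (parallel edges allowed). Augmentations: an edge of a graph is flat if it lies in no triangle. Let $xy$ be a flat edge of a graph $G_0$ and let $B=(A,C)$ be a co-bipartite graph disjoint from $G_0$ whose vertex set is partitioned into cliques $A$ and $C$, with at least one edge between $A$ and $C$. Augmenting $G_0$ along $xy$ with augment $B$ means taking the disjoint union of $G_0-\{x,y\}$ and $B$ and adding all edges between $A$ and $N(x)\setminus\{y\}$ and all edges between $C$ and $N(y)\setminus\{x\}$. An augmentation of $G_0$ is a graph obtained by choosing a (possibly empty) matching $x_1y_1,\dots,x_ky_k$ of flat edges of $G_0$ and co-bipartite graphs $B_i=(A_i,C_i)$ with at least one $A_iC_i$-edge, and augmenting each $x_iy_i$ with augment $B_i$ (the order is irrelevant). If $G_0$ is the line graph of a bipartite multigraph $H(X,Y)$ and the matching is $e_1f_1,\dots,e_kf_k$ (so the $e_i,f_i$ are edges of $H$), the augmentation is an $X$-augmentation if for each $i$ there is a vertex $x_i\in X$ incident in $H$ with both $e_i$ and $f_i$. *)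

(* Defs.v *)
From Stdlib Require List.
From mathcomp Require Import all_boot.

Set Implicit Arguments.
Unset Strict Implicit.
Unset Printing Implicit Defensive.

Record sgraph := SGraph {
  svertex :> finType;
  sadj : rel svertex;
  sadj_sym : symmetric sadj;
  sadj_irr : irreflexive sadj }.

Notation "x -- y" := (sadj x y) (at level 30, no associativity).

Definition nbr (G : sgraph) (x : G) : {set G} := [set y | x -- y].

Definition clique (G : sgraph) (A : {set G}) : Prop :=
  forall x y, x \in A -> y \in A -> x != y -> x -- y.

Definition sg_iso (G G' : sgraph) : Prop :=
  exists f : G -> G', bijective f /\ forall x y, f x -- f y = x -- y.

Section Induced.
Variables (G : sgraph) (S : {set G}).
Definition induced_adj : rel {x : G | x \in S} := fun u v => val u -- val v.
Lemma induced_sym : symmetric induced_adj.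
Proof. by move=> u v; apply: sadj_sym. Qed.
Lemma induced_irr : irreflexive induced_adj.
Proof. by move=> u; apply: sadj_irr. Qed.
Definition induced : sgraph := SGraph induced_sym induced_irr.
End Induced.

Section CompleteGraph.
Variable n : nat.
Definition complete_adj : rel 'I_n := fun i j => i != j.
Lemma complete_sym : symmetric complete_adj.
Proof. by move=> i j; rewrite /complete_adj eq_sym. Qed.
Lemma complete_irr : irreflexive complete_adj.
Proof. by move=> i; rewrite /complete_adj eqxx. Qed.
Definition complete_graph : sgraph := SGraph complete_sym complete_irr.
End CompleteGraph.

Section PathGraph.
Variable n : nat.
Definition path_adj : rel 'I_n := fun i j => (i.+1 == j) || (j.+1 == i).
Lemma path_adj_sym : symmetric path_adj.
Proof. by move=> i j; rewrite /path_adj orbC. Qed.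
Lemma path_adj_irr : irreflexive path_adj.
Proof. by move=> i; rewrite /path_adj orbb eqn_leq ltnn. Qed.
Definition path_graph : sgraph := SGraph path_adj_sym path_adj_irr.
End PathGraph.

Inductive colour := red | blue.

(* The colour of the edge xy is the value at [set x; y]; the values at sets
   that are not edges are irrelevant and never inspected. *)
Definition edge_colouring (G : sgraph) := {set G} -> colour.

Record ecgraph := ECGraph {
  ecg :> sgraph;
  ecol : edge_colouring ecg }.

Definition ec_iso (P Q : ecgraph) : Prop :=
  exists f : P -> Q,
    [/\ bijective f,
        forall x y, f x -- f y = x -- y
      & forall x y, x -- y -> ecol [set f x; f y] = ecol [set x; y]].

Definition ec_induced (G : ecgraph) (S : {set G}) : ecgraph :=
  @ECGraph (induced S) (fun e => ecol [set val u | u in e]).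

Definition ec_free (F : seq ecgraph) (G : ecgraph) : Prop :=
  forall P, List.In P F -> forall S : {set G}, ~ ec_iso (ec_induced S) P.

Definition admits_free (F : seq ecgraph) (G : sgraph) : Prop :=
  exists c : edge_colouring G, ec_free F (ECGraph c).

Definition rP3 := @ECGraph (path_graph 3) (fun=> red).
Definition bP3 := @ECGraph (path_graph 3) (fun=> blue).
Definition rK3 := @ECGraph (complete_graph 3) (fun=> red).
Definition bK3 := @ECGraph (complete_graph 3) (fun=> blue).
(* The two edges at vertex 0 have one colour, the edge {1, 2} the other. *)
Definition rrbK3 :=
  @ECGraph (complete_graph 3) (fun e => if ord0 \in e then red else blue).
Definition rbbK3 :=
  @ECGraph (complete_graph 3) (fun e => if ord0 \in e then blue else red).

(* Loopless multigraphs: parallel edges are distinct elements of [medge] with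
   the same ends. *)
Record mgraph := MGraph {
  mvertex : finType;
  medge : finType;
  mends : medge -> {set mvertex};
  card_mends : forall e, #|mends e| = 2 }.

Section MGraphOf.
Variable G : sgraph.
Definition is_edge (e : {set G}) : bool :=
  [exists x, exists y, (x -- y) && (e == [set x; y])].
Lemma card_is_edge (e : {e : {set G} | is_edge e}) : #|val e| = 2.
Proof.
case: e => e /= /existsP[x /existsP[y /andP[xy /eqP->]]].
rewrite cards2; case: eqVneq => // eq_xy.
by move: xy; rewrite eq_xy sadj_irr.
Qed.
Definition mgraph_of : mgraph := MGraph card_is_edge.
End MGraphOf.

Section LineGraph.
Variable H : mgraph.
Definition line_adj : rel (medge H) :=
  fun e f => (e != f) && (mends e :&: mends f != set0).
Lemma line_sym : symmetric line_adj.
Proof. by move=> e f; rewrite /line_adj eq_sym setIC. Qed.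
Lemma line_irr : irreflexive line_adj.
Proof. by move=> e; rewrite /line_adj eqxx. Qed.
Definition line_graph : sgraph := SGraph line_sym line_irr.
End LineGraph.

Definition bipartition (H : mgraph) (X Y : {set mvertex H}) : Prop :=
  [/\ X :|: Y = setT, [disjoint X & Y]
    & forall e : medge H,
        exists x y, [/\ x \in X, y \in Y & mends e = [set x; y]]].

Definition mnbr (H : mgraph) (x : mvertex H) : {set mvertex H} :=
  [set y | [exists e : medge H, mends e == [set x; y]]].

Definition incidence_mgraph (H : mgraph) (X Y : {set mvertex H}) : Prop :=
  bipartition X Y /\ forall x, x \in X -> #|mnbr x| <= 2.

Definition incidence_graph (H : sgraph) (X Y : {set H}) : Prop :=
  @bipartition (mgraph_of H) X Y /\ forall x, x \in X -> #|nbr x| <= 2.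

Definition flat (G : sgraph) (x y : G) : Prop :=
  x -- y /\ forall z, ~~ ((x -- z) && (y -- z)).

Definition matching (G : sgraph) (M : seq (G * G)) : Prop :=
  (forall p, p \in M -> p.1 -- p.2) /\ uniq (map fst M ++ map snd M).

Record augment := Augment {
  aug_graph :> sgraph;
  augA : {set aug_graph};
  augC : {set aug_graph};
  aug_cover : augA :|: augC = setT;
  aug_disj : [disjoint augA & augC];
  aug_cliqueA : clique augA;
  aug_cliqueC : clique augC;
  aug_edge : exists a c, [/\ a \in augA, c \in augC & a -- c] }.

Definition kept (G : sgraph) (x y : G) : finType :=
  {v : G | v \notin [set x; y]}.

Section AugmentAlong.
Variables (G : sgraph) (x y : G) (B : augment).
Definition cross_adj (v : kept x y) (b : B) : bool :=
  (b \in augA B) && (val v \in nbr x :\ y)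
  || (b \in augC B) && (val v \in nbr y :\ x).
Definition augment_adj : rel (kept x y + B)%type := fun u v =>
  match u, v with
  | inl u, inl v => val u -- val v
  | inr a, inr b => a -- b
  | inl v, inr b | inr b, inl v => cross_adj v b
  end.
Lemma augment_sym : symmetric augment_adj.
Proof. by move=> [u|a] [v|b] //=; apply: sadj_sym. Qed.
Lemma augment_irr : irreflexive augment_adj.
Proof. by move=> [u|a] /=; apply: sadj_irr. Qed.
Definition augment_along : sgraph := SGraph augment_sym augment_irr.
End AugmentAlong.

(* [augmented M G]: up to isomorphism, G arises from G0 by augmenting the
   pairs of M one after the other, each with an arbitrary augment. The pairs
   still to be treated avoid x and y, so they survive as vertices of
   [augment_along x y B]. *)
Inductive augmented : forall G0 : sgraph, seq (G0 * G0) -> sgraph -> Prop :=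
| augmented_nil (G0 G : sgraph) : sg_iso G G0 -> @augmented G0 [::] G
| augmented_cons (G0 : sgraph) (x y : G0) (B : augment)
    (M : seq (kept x y * kept x y)) (G : sgraph) :
    @augmented (augment_along x y B) [seq (inl p.1, inl p.2) | p <- M] G ->
    @augmented G0 ((x, y) :: [seq (val p.1, val p.2) | p <- M]) G.

(* G is an X-augmentation of the line graph of H. *)
Definition X_augmentation (H : mgraph) (X : {set mvertex H}) (G : sgraph)
    : Prop :=
  exists M : seq (line_graph H * line_graph H),
    [/\ matching M,
        forall e f, (e, f) \in M -> flat e f,
        forall e f, (e, f) \in M ->
          exists x : mvertex H, [/\ x \in X, x \in mends e & x \in mends f]
      & augmented M G].

(* Main.v *)
(* A colouring avoiding bP3, rP3, bK3 and rrbK3 is a partition of the vertices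
   into (red) cliques such that all neighbours of a vertex outside its class lie
   in a single class. Contracting, for each pair of classes, the co-bipartite
   graph spanned by the vertices with neighbours across to one flat edge leaves
   the line graph of an incidence graph, whose Y-vertices are the classes; and
   conversely the partition "same Y-end" of a line graph survives
   X-augmentations.

   When only bP3, rP3 and bK3 are avoided, rrb triangles may occur. Call
   (x, y, z, w) a diamond if x, w are not adjacent, xy, zw are blue and xz, yw,
   yz are red. Recolouring yz blue destroys this diamond, keeps the colouring
   valid and creates no new diamond. Without diamonds, the blue edge of any rrb
   triangle can be recoloured red, and this creates no diamond either. *)

Require Import Defs.
From mathcomp Require Import all_boot.

Set Implicit Arguments.
Unset Strict Implicit.
Unset Printing Implicit Defensive.

(** * Partitions into cliques and forbidden patterns *)

(** The fibres of [k] are the classes of the partition. Labels need not all occur, so a labelling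
    can be composed with an isomorphism or extended to a larger label type. *)
Definition clique_labelling (G : sgraph) (T : Type) (k : G -> T) : Prop :=
  (forall x y, k x = k y -> x != y -> x -- y) /\
  (forall x y z, x -- y -> x -- z -> k x <> k y -> k x <> k z -> k y = k z).

Definition clique_labelled (G : sgraph) : Prop :=
  exists (T : finType) (k : G -> T), clique_labelling k.

Definition ec_embedding (P G : ecgraph) (f : P -> G) : Prop :=
  [/\ injective f, forall x y, f x -- f y = x -- y
    & forall x y, x -- y -> ecol [set f x; f y] = ecol [set x; y]].

(** To exhibit a pattern it then suffices to list its vertices in [G]. An induced copy and an
    embedding determine each other: the copy lives on the range of [f]. *)
Lemma ec_freeP (F : seq ecgraph) (G : ecgraph) :
  ec_free F G <->
  forall P, List.In P F -> forall f : P -> G, ~ ec_embedding f.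
Proof.
have valU (S : {set G}) (u v : {x | x \in S}) :
    [set val w | w in [set u; v]] = [set val u; val v].
  by rewrite imsetU1 imset_set1.
split=> freeG P FP => [f [f_inj f_adj f_col] | S [g [[h gK hK] g_adj g_col]]].
  have codomP (u : {x : G | x \in [set y in codom f]}) : val u \in codom f.
    by have := valP u; rewrite inE.
  pose g u := iinv (codomP u).
  have fg u : f (g u) = val u by apply: f_iinv.
  have im p : f p \in [set y in codom f] by rewrite inE codom_f.
  apply: (freeG P FP [set y in codom f]); exists g; split=> [|u v|u v uv].
  - exists (fun p => exist _ (f p) (im p)) => [u|p].
      by apply: val_inj; rewrite /= fg.
    by apply: f_inj; rewrite fg.
  - by rewrite -f_adj !fg.
  - by rewrite /= valU -!fg f_col // -f_adj !fg.
apply: (freeG P FP (fun p => val (h p))); split=> [p q /val_inj|p q|p q pq].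
- exact: (can_inj hK).
- by rewrite -[p in RHS]hK -[q in RHS]hK g_adj.
- have /g_col : h p -- h q by rewrite -g_adj !hK.
  by rewrite !hK /= valU => ->.
Qed.

Definition opp_colour (a : colour) := if a is red then blue else red.

Definition same_colour (a b : colour) : bool :=
  match a, b with red, red | blue, blue => true | _, _ => false end.

Lemma same_colourP a b : reflect (a = b) (same_colour a b).
Proof. by case: a b => [] []; constructor. Qed.

Lemma same_colourN a b : ~~ same_colour a b -> b = opp_colour a.
Proof. by case: a b => [] []. Qed.

Lemma colourVopp a b : b = a \/ b = opp_colour a.
Proof. by case: a b => [] []; auto. Qed.

Lemma opp_colour_neq a : a <> opp_colour a.
Proof. by case: a. Qed.

(** With the colour as a parameter both colours are treated at once. For a concrete colour these
    reduce to the named patterns; [mixedK3 red] is convertible to [rrbK3] and [mixedK3 blue] to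
    [rbbK3]. *)
Definition monoP3 a := @ECGraph (path_graph 3) (fun=> a).
Definition monoK3 a := @ECGraph (complete_graph 3) (fun=> a).
Definition mixedK3 a := @ECGraph (complete_graph 3)
  (fun e => if ord0 \in e then a else opp_colour a).

Definition ord3 (T : Type) (x y z : T) (i : 'I_3) : T := nth x [:: x; y; z] i.

Lemma monoP3_embedding a (G : ecgraph) (x y z : G) :
  x -- y -> y -- z -> ~~ x -- z -> x != z ->
  ecol [set x; y] = a -> ecol [set y; z] = a ->
  @ec_embedding (monoP3 a) G (ord3 x y z).
Proof.
move=> xy yz xz nxz cxy cyz.
have nxy : x != y by apply: contraTneq xy => ->; rewrite sadj_irr.
have nyz : y != z by apply: contraTneq yz => ->; rewrite sadj_irr.
move/negbTE in xz; split.
- case=> [[|[|[|i]]] Hi] // [[|[|[|j]]] Hj] //= /eqP;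
    rewrite /ord3 /= ?(eq_sym y x) ?(eq_sym z) ?(negbTE nxy) ?(negbTE nyz)
      ?(negbTE nxz) // => _; exact: val_inj.
- case=> [[|[|[|i]]] Hi] // [[|[|[|j]]] Hj] //=;
  by rewrite /ord3 /= ?sadj_irr // ?xy ?yz ?xz // sadj_sym ?xy ?yz ?xz.
- case=> [[|[|[|i]]] Hi] // [[|[|[|j]]] Hj] //= _;
  by rewrite /ord3 /= // setUC.
Qed.

Lemma monoK3_embedding a (G : ecgraph) (x y z : G) :
  x -- y -> y -- z -> x -- z ->
  ecol [set x; y] = a -> ecol [set y; z] = a -> ecol [set x; z] = a ->
  @ec_embedding (monoK3 a) G (ord3 x y z).
Proof.
move=> xy yz xz cxy cyz cxz.
have nxy : x != y by apply: contraTneq xy => ->; rewrite sadj_irr.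
have nyz : y != z by apply: contraTneq yz => ->; rewrite sadj_irr.
have nxz : x != z by apply: contraTneq xz => ->; rewrite sadj_irr.
split.
- case=> [[|[|[|i]]] Hi] // [[|[|[|j]]] Hj] //= /eqP;
    rewrite /ord3 /= ?(eq_sym y x) ?(eq_sym z) ?(negbTE nxy) ?(negbTE nyz)
      ?(negbTE nxz) // => _; exact: val_inj.
- case=> [[|[|[|i]]] Hi] // [[|[|[|j]]] Hj] //=;
  by rewrite /ord3 /complete_adj /= ?sadj_irr // ?xy ?yz ?xz // sadj_sym
      ?xy ?yz ?xz.
- case=> [[|[|[|i]]] Hi] // [[|[|[|j]]] Hj] //= _;
  by rewrite /ord3 /= // setUC.
Qed.

(** * Removing rrb triangles by recolouring *)

Section RedBlue.
Variable G : sgraph.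

Definition blue_of (r : rel G) : rel G := fun x y => (x -- y) && ~~ r x y.

(* [r] means "joined by a red edge". The last two conditions exclude rP3 and
   the pair bP3, bK3, respectively. *)
Definition red_blue (r : rel G) : Prop :=
  [/\ symmetric r, forall x y, r x y -> x -- y,
      forall x y z, r x y -> r y z -> x != z -> x -- z
    & forall x y z, blue_of r x y -> blue_of r y z -> x != z -> r x z].

Definition diamond (r : rel G) (x y z w : G) : bool :=
  [&& ~~ x -- w, blue_of r x y, blue_of r z w, r x z, r y w & r y z].

Lemma blue_of_sym r : symmetric r -> symmetric (blue_of r).
Proof. by move=> rs x y; rewrite /blue_of sadj_sym rs. Qed.

Lemma blue_red r x y : blue_of r x y -> r x y -> False.
Proof. by case/andP=> _ /negP. Qed.

Lemma redVblue (r : rel G) x y : x -- y -> r x y \/ blue_of r x y.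
Proof. by move=> xy; rewrite /blue_of xy; case: (r x y); [left|right]. Qed.

Lemma diamond_sym r x y z w :
  symmetric r -> diamond r x y z w -> diamond r w z y x.
Proof.
move=> rs /and5P[xw xy zw xz /andP[yw yz]]; have bs := blue_of_sym rs.
by rewrite /diamond sadj_sym xw bs zw bs xy rs yw rs xz rs yz.
Qed.

Definition is_pair (y z u v : G) : bool :=
  (u == y) && (v == z) || (u == z) && (v == y).

Lemma is_pair_sym y z u v : is_pair y z u v = is_pair y z v u.
Proof. by rewrite /is_pair orbC andbC [(v == z) && _]andbC. Qed.

Lemma is_pairP y z u v :
  reflect ((u = y /\ v = z) \/ (u = z /\ v = y)) (is_pair y z u v).
Proof.
apply: (iffP orP) => [[] /andP[/eqP-> /eqP->]|[] [-> ->]]; rewrite ?eqxx; auto.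
Qed.

Section Flip.
Variables (r : rel G) (x y z w : G).
Hypotheses (rb : red_blue r) (dr : diamond r x y z w).

Let r' : rel G := fun u v => r u v && ~~ is_pair y z u v.

Lemma flip_blue u v : blue_of r' u v -> blue_of r u v \/ is_pair y z u v.
Proof.
rewrite /blue_of /r' => /andP[->]; rewrite negb_and negbK.
by case/orP=> [->|->]; [left|right].
Qed.

(** Two blue edges at [y] make [ux] red, two at [z] make [uw] red, and the red path [x], [u], [w]
    would force the missing edge [xw]. *)
Lemma diamond_no_blue u : blue_of r u y -> blue_of r u z -> False.
Proof.
have [rs radj red2 blue2] := rb; have bs := blue_of_sym rs.
have /and5P[xw xy zw xz /andP[yw yz]] := dr.
move=> uy uz.
have ux : u != x.
  by apply/eqP=> E; subst u; apply: blue_red uz xz.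
have uw : u != w.
  by apply/eqP=> E; subst u; apply: blue_red uy _; rewrite rs.
have rux : r u x by apply: (blue2 _ y); rewrite 1?bs // bs.
have ruw : r u w by apply: (blue2 _ z).
case/negP: xw; apply: (red2 _ u) => //; first by rewrite rs.
by apply/eqP=> E; subst w; apply: blue_red xy _; rewrite rs.
Qed.

(** Two blue edges at [z] make [tw] red, so the red path [t], [w], [y] makes [t] and [y] adjacent; a
    blue edge there would give [y] and [z] a common blue neighbour. *)
Lemma flip_blue_y t : blue_of r z t -> r y t.
Proof.
have [rs radj red2 blue2] := rb; have bs := blue_of_sym rs.
have /and5P[xw xy zw xz /andP[yw yz]] := dr.
move=> zt; have [->//|tw] := eqVneq t w.
have ty : t != y.
  by apply/eqP=> E; subst t; apply: blue_red zt _; rewrite rs.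
have rtw : r t w by apply: (blue2 _ z); rewrite // bs.
have aty : t -- y by apply: (red2 _ w) => //; rewrite rs.
case: (redVblue r aty) => [|bty]; first by rewrite rs.
by case: (@diamond_no_blue t); rewrite // bs.
Qed.
End Flip.

Lemma is_pair_fun y z u v t :
  y != z -> is_pair y z u v -> is_pair y z u t -> v = t.
Proof.
move=> nyz /is_pairP[] [-> ->] /is_pairP[] [] => [_ -> //|E|E|_ -> //].
  by rewrite E eqxx in nyz.
by rewrite E eqxx in nyz.
Qed.

(** Losing a red edge cannot hurt the red condition, whose conclusion is mere adjacency. For two
    blue edges, either one of them is the new blue edge, which is [flip_blue_y], or both are old,
    and then their ends are not the flipped pair by [diamond_no_blue]. *)
Lemma flip_red_blue r x y z w : red_blue r -> diamond r x y z w ->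
  red_blue (fun u v => r u v && ~~ is_pair y z u v).
Proof.
move=> rb dr; have [rs radj red2 blue2] := rb; have bs := blue_of_sym rs.
have dr' := diamond_sym rs dr.
have nyz : y != z.
  have /and5P[_ _ _ _ /andP[_ /radj]] := dr.
  by apply: contraTneq => ->; rewrite sadj_irr.
have key u v t : is_pair y z u v -> blue_of r v t -> r u t.
  case/is_pairP=> [] [-> ->]; first exact: flip_blue_y rb dr _.
  exact: flip_blue_y rb dr' _.
split=> [u v|u v|u v t|u v t].
- by rewrite rs is_pair_sym.
- by case/andP=> /radj.
- by case/andP=> uv _ /andP[vt _]; apply: red2 uv vt.
move=> buv' bvt' ut.
have uv : u -- v by case/andP: buv'.
have vt : v -- t by case/andP: bvt'.
have [buv|p] := flip_blue buv'; have [bvt|q] := flip_blue bvt'.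
- rewrite (blue2 u v t) //=; apply/negP=> /is_pairP ptu; rewrite bs in buv.
  by case: ptu => [] [Eu Et]; subst; apply: (diamond_no_blue rb dr (u := v)).
- have tv : is_pair y z t v by rewrite is_pair_sym.
  rewrite [r u t]rs (@key t v u) // 1?bs //= is_pair_sym.
  apply/negP=> tu; have E := is_pair_fun nyz tv tu.
  by rewrite E sadj_irr in uv.
- rewrite (@key u v t) //=; apply/negP=> tu; have E := is_pair_fun nyz p tu.
  by rewrite E sadj_irr in vt.
- rewrite is_pair_sym in p; have E := is_pair_fun nyz p q.
  by rewrite E eqxx in ut.
Qed.

(** The red edges of the diamond were red before. Had [XY] or [ZW] been red too, there would be a
    red path from [X] to [W], forcing the edge [XW]. *)
Lemma flip_diamond r y z X Y Z W : red_blue r ->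
  diamond (fun u v => r u v && ~~ is_pair y z u v) X Y Z W ->
  diamond r X Y Z W.
Proof.
move=> [rs radj red2 blue2] /and5P[XW XY ZW XZ /andP[YW YZ]].
have [rXZ _] := andP XZ; have [rYW _] := andP YW; have [rYZ _] := andP YZ.
apply/and5P; split; rewrite // ?rYW //.
  have [aXY _] := andP XY; have [rXY|//] := redVblue r aXY.
  case/negP: XW; apply: red2 rXY rYW _; apply/eqP=> E; subst W.
  by apply: blue_red XY _; rewrite rs is_pair_sym.
have [aZW _] := andP ZW; have [rZW|//] := redVblue r aZW.
case/negP: XW; apply: red2 rXZ rZW _; apply/eqP=> E; subst W.
by apply: blue_red ZW _; rewrite rs is_pair_sym.
Qed.

(** Induction on the number of quadruples that form a diamond: a flip removes the chosen one and
    adds none. *)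
Lemma diamond_free_red_blue r : red_blue r ->
  exists2 r', red_blue r' & forall x y z w, ~~ diamond r' x y z w.
Proof.
pose D (r : rel G) :=
  [set q : G * G * (G * G) | diamond r q.1.1 q.1.2 q.2.1 q.2.2].
have [n] := ubnP #|D r|; elim: n r => // n IHn r ltn rb.
have [D0|[[[x y] [z w]]]] := set_0Vmem (D r).
  exists r => // x y z w; apply/negP=> d.
  by have := in_set0 ((x, y), (z, w)); rewrite -D0 inE d.
rewrite inE /= => d; apply: IHn (flip_red_blue rb d).
rewrite -ltnS; apply: leq_trans ltn; rewrite ltnS; apply: proper_card.
apply/properP; split.
  by apply/subsetP=> q; rewrite !inE; apply: flip_diamond rb.
exists ((x, y), (z, w)); rewrite !inE //=.
apply/negP=> /and5P[_ _ _ _ /andP[_ /andP[_]]].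
by rewrite /is_pair !eqxx.
Qed.

Section Recolour.
Variables (r : rel G) (x y z : G).
Hypotheses (rb : red_blue r) (no_dr : forall x y z w, ~~ diamond r x y z w).
Hypotheses (xy : blue_of r x y) (xz : r x z) (zy : r z y).

Let r' : rel G := fun u v => r u v || is_pair x y u v.

Lemma recolour_blue u v : blue_of r' u v -> blue_of r u v.
Proof. by case/andP=> uv; rewrite /r' negb_or => /andP[nr _]; apply/andP. Qed.

Lemma recolour_red u v : r' u v -> r u v \/ is_pair x y u v.
Proof. by case/orP; [left|right]. Qed.

(** The only new red paths contain the recoloured edge. For such a path [a], [b], [t], the red path
    [z], [b], [t] gives the edge [zt] (unless [t] is [z]). If it is red, so is the path [a], [z],
    [t]; if it is blue, a missing edge [at] would make [a], [b], [z], [t] a diamond. *)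
Lemma recolour_adj u v t : is_pair x y u v -> r v t -> u != t -> u -- t.
Proof.
have [rs radj red2 blue2] := rb; have bs := blue_of_sym rs.
suff main a b : blue_of r a b -> r a z -> r z b -> r b t -> a != t -> a -- t.
  by case/is_pairP=> [] [-> ->]; apply: main; rewrite // 1?bs // 1?rs.
move=> ab az zb bt nat; have [//|nadj] := boolP (a -- t).
have [E|ntz] := eqVneq z t; first by subst t; rewrite radj in nadj.
have tz : z -- t by apply: red2 zb bt ntz.
have [rzt|bzt] := redVblue r tz.
  by case/negP: nadj; apply: red2 az rzt nat.
have /negP[] := no_dr a b z t.
by apply/and5P; split; rewrite // bt rs.
Qed.

Lemma recolour_red_blue : red_blue r'.
Proof.
have [rs radj red2 blue2] := rb; have bs := blue_of_sym rs.
have axy : x -- y by case/andP: xy.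
have nxy : x != y by apply: contraTneq axy => ->; rewrite sadj_irr.
split=> [u v|u v|u v t|u v t].
- by rewrite /r' rs is_pair_sym.
- by case/recolour_red=> [/radj //|/is_pairP[] [-> ->] //]; rewrite sadj_sym.
- move=> /recolour_red uv /recolour_red vt ut.
  case: uv => [uv|p]; case: vt => [vt|q].
  + exact: red2 uv vt ut.
  + rewrite sadj_sym; apply: (@recolour_adj t v); rewrite 1?is_pair_sym //.
      by rewrite rs.
    by rewrite eq_sym.
  + exact: recolour_adj p vt ut.
  + rewrite is_pair_sym in p; have E := is_pair_fun nxy p q.
    by rewrite E eqxx in ut.
by move=> /recolour_blue uv /recolour_blue vt ut; rewrite /r' (blue2 u v t).
Qed.

(** A new diamond has the recoloured edge among its red ones. If that is [XZ] or [YW], two formerly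
    blue edges force [XW]. If it is [YZ], then [z] is adjacent to [X] and [W], and each colouring of
    these two edges yields [XW] or an old diamond. *)
Lemma recolour_no_diamond X Y Z W : ~~ diamond r' X Y Z W.
Proof.
have [rs radj red2 blue2] := rb; have bs := blue_of_sym rs.
apply/negP=> /and5P[XW bXY' bZW' rXZ' /andP[rYW' rYZ']].
have bXY := recolour_blue bXY'; have bZW := recolour_blue bZW'.
have nXW : X != W.
  apply/eqP=> E; subst W; apply: blue_red bZW' _.
  by have [-> _ _ _] := recolour_red_blue.
have pair_blue u v : is_pair x y u v -> blue_of r u v.
  by case/is_pairP=> [] [-> ->] //; rewrite bs.
have XWN : r X W -> False by move/radj; apply/negP.
have [rXZ|/pair_blue bXZ] := recolour_red rXZ'; last first.
  by apply: XWN; apply: blue2 bXZ bZW nXW.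
have [rYW|/pair_blue bYW] := recolour_red rYW'; last first.
  by apply: XWN; apply: blue2 bXY bYW nXW.
have [rYZ|p] := recolour_red rYZ'.
  by case/negP: (no_dr X Y Z W); apply/and5P; split; rewrite // rYW.
have [rYz rzZ] : r Y z /\ r z Z.
  by case/is_pairP: p => [] [-> ->]; split; rewrite // rs.
have Xz : X -- z.
  apply: (red2 _ Z) => //; first by rewrite rs.
  by apply/eqP=> E; subst X; apply: blue_red bXY _; rewrite rs.
have zW : z -- W.
  apply: (red2 _ Y) => //; first by rewrite rs.
  by apply/eqP=> E; subst W; apply: blue_red bZW _; rewrite rs.
have [rXz|bXz] := redVblue r Xz; have [rzW|bzW] := redVblue r zW.
- by case/negP: XW; apply: red2 rXz rzW nXW.
- by case/negP: (no_dr X Y z W); apply/and5P; split; rewrite // rYW.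
- by case/negP: (no_dr X z Z W); apply/and5P; split; rewrite // rzW.
- by apply: XWN; apply: blue2 bXz bzW nXW.
Qed.
End Recolour.

(** Transitivity of red says that there is no rrb triangle. Diamonds are removed first; then the
    number of blue pairs decreases while diamond-freeness is maintained. *)
Lemma transitive_red_blue r : red_blue r -> exists2 r', red_blue r' &
  forall x y z, r' x y -> r' y z -> x != z -> r' x z.
Proof.
case/diamond_free_red_blue=> {}r rb no_dr.
pose B (r : rel G) := [set p : G * G | blue_of r p.1 p.2].
have [n] := ubnP #|B r|; elim: n r rb no_dr => // n IHn r rb no_dr ltn.
have [rs radj red2 blue2] := rb.
have [/existsP[[[x y] z] /and3P[/= xy xz zy]]|noT] := boolP
    [exists t : G * G * G,
      [&& blue_of r t.1.1 t.1.2, r t.1.1 t.2 & r t.2 t.1.2]]; last first.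
  exists r => // x y z xy yz xz.
  have [//|b] := redVblue r (red2 _ _ _ xy yz xz).
  by case/negP: noT; apply/existsP; exists (x, z, y); rewrite /= b xy.
apply: IHn (recolour_red_blue rb no_dr xy xz zy)
  (recolour_no_diamond rb no_dr xy xz zy) _.
rewrite -ltnS; apply: leq_trans ltn; rewrite ltnS; apply: proper_card.
apply/properP; split.
  by apply/subsetP=> q; rewrite !inE; apply: recolour_blue.
exists (x, y); rewrite !inE //=.
by rewrite /blue_of /is_pair !eqxx orbT andbF.
Qed.
End RedBlue.

(** For transitive red, closed red neighbourhoods are equivalence classes and serve as labels.
    Neighbours of [x] outside its class are blue neighbours, hence joined in red whenever
    distinct. *)
Lemma red_blue_labelled (G : sgraph) (r : rel G) :
  red_blue r -> clique_labelled G.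
Proof.
case/transitive_red_blue=> {}r [rs radj red2 blue2] rtr.
exists {set G}, (fun v => [set w | (w == v) || r v w]).
have kE x y : x != y -> r x y ->
    [set w | (w == x) || r x w] = [set w | (w == y) || r y w].
  move=> nxy rxy; apply/setP=> w; rewrite !inE.
  have [->|nwx] := eqVneq w x; first by rewrite rs rxy orbT.
  have [->|nwy] := eqVneq w y; first by rewrite rxy.
  apply/idP/idP=> /= rw; [apply: (rtr _ x)|apply: (rtr _ y)] => //.
  - by rewrite rs.
  - by rewrite eq_sym.
  - by rewrite eq_sym.
split=> [x y /setP/(_ y)|x y z xy xz kxy kxz].
  by rewrite !inE eqxx eq_sym => /orP[->|/radj].
have blue v : x -- v ->
    [set w | (w == x) || r x w] <> [set w | (w == v) || r v w] -> blue_of r x v.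
  move=> xv kxv; rewrite /blue_of xv; apply/negP=> rxv; apply: kxv.
  by apply: kE rxv; apply: contraTneq xv => ->; rewrite sadj_irr.
have [-> //|nyz] := eqVneq y z.
apply: kE => //; apply: (blue2 _ x) => //; last exact: blue xz kxz.
by rewrite (blue_of_sym rs); apply: blue xy kxy.
Qed.

(** * Colourings and labellings; [a] is the colour inside the classes *)

Definition patterns_mono a := [:: bP3; rP3; monoK3 (opp_colour a)].
Definition patterns_mixed a :=
  [:: bP3; rP3; monoK3 (opp_colour a); mixedK3 a].

Lemma patterns_mono_labelled a (G : sgraph) :
  admits_free (patterns_mono a) G -> clique_labelled G.
Proof.
case=> c /ec_freeP cfree.
have nK3 f : ~ @ec_embedding (monoK3 (opp_colour a)) (ECGraph c) f.
  by apply: cfree; right; right; left.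
have nP3 b f : ~ @ec_embedding (monoP3 b) (ECGraph c) f.
  by case: b f; apply: cfree; [right; left|left].
pose r (x y : G) := (x -- y) && same_colour a (c [set x; y]).
have blueE x y : blue_of r x y -> x -- y /\ c [set x; y] = opp_colour a.
  by case/andP=> xy; rewrite /r xy => /same_colourN.
have rs : symmetric r by move=> x y; rewrite /r sadj_sym setUC.
apply: (@red_blue_labelled G r); split=> // [x y /andP[] //|x y z|x y z].
  move=> /andP[xy /same_colourP cxy] /andP[yz /same_colourP cyz] nxz.
  apply/idPn=> xz; apply: (nP3 a (ord3 x y z)).
  exact: monoP3_embedding.
move=> /blueE[xy cxy] /blueE[yz cyz] nxz.
have [xz|xz] := boolP (x -- z); last first.
  by case: (nP3 (opp_colour a) (ord3 x y z)); apply: monoP3_embedding.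
have [//|/blueE[_ cxz]] := redVblue r xz.
by case: (nK3 (ord3 x y z)); apply: monoK3_embedding.
Qed.

(** Edges inside classes get colour [a], the others the opposite one. Either monochromatic path has
    its ends in one class, so they are adjacent; a triangle cannot have all its edges between
    classes, nor exactly two inside. *)
Lemma labelled_patterns_mixed a (G : sgraph) :
  clique_labelled G -> admits_free (patterns_mixed a) G.
Proof.
case=> T [k [k_clique k_out]].
(* A colouring is defined on all vertex sets, so the two ends have to be recovered from the set. *)
pose c : edge_colouring G := fun e =>
  if [exists x, exists y, (e == [set x; y]) && (k x == k y)] then a
  else opp_colour a.
have cE x y : x -- y -> c [set x; y] = if k x == k y then a else opp_colour a.
  move=> xy; have nxy : x != y by apply: contraTneq xy => ->; rewrite sadj_irr.
  rewrite /c; case: ifP => [/existsP[u /existsP[v /andP[/eqP E kuv]]]|nE].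
    have : x \in [set u; v] by rewrite -E !inE eqxx.
    have : y \in [set u; v] by rewrite -E !inE eqxx orbT.
    rewrite !inE => /orP[]/eqP Ey /orP[]/eqP Ex; subst.
    - by rewrite eqxx in nxy.
    - by rewrite eq_sym kuv.
    - by rewrite kuv.
    - by rewrite eqxx in nxy.
  case: ifP => // kxy; case/negP: (negbT nE).
  by apply/existsP; exists x; apply/existsP; exists y; rewrite eqxx.
exists c; apply/ec_freeP.
have major x y : x -- y -> c [set x; y] = a -> k x = k y.
  move=> xy; rewrite cE //; case: eqP => // _ E.
  by case: (opp_colour_neq (esym E)).
have minor x y : x -- y -> c [set x; y] = opp_colour a -> k x <> k y.
  move=> xy; rewrite cE //; case: eqP => // _ E.
  by case: (opp_colour_neq E).
have nP3 b f : ~ @ec_embedding (monoP3 b) (ECGraph c) f.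
  case=> f_inj f_adj f_col.
  pose i0 : 'I_3 := inord 0; pose i1 : 'I_3 := inord 1.
  pose i2 : 'I_3 := inord 2.
  have e01 : sadj (i0 : monoP3 b) i1 by rewrite /= /path_adj !inordK.
  have e12 : sadj (i1 : monoP3 b) i2 by rewrite /= /path_adj !inordK.
  have n02 : ~~ sadj (i0 : monoP3 b) i2 by rewrite /= /path_adj !inordK.
  have f02 : f i0 != f i2.
    by rewrite (inj_eq f_inj) -val_eqE /= !inordK.
  have c01 := f_col _ _ e01; have c12 := f_col _ _ e12.
  rewrite -f_adj in e01; rewrite -f_adj in e12; rewrite -f_adj in n02.
  case/negP: n02; apply: k_clique f02.
  have [E|E] := colourVopp a b; rewrite E in c01 c12.
    by rewrite (major _ _ e01 c01) (major _ _ e12 c12).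
  apply: (k_out (f i1)); rewrite // 1?sadj_sym //; last exact: minor.
  by apply/nesym; apply: minor.
have K3 P f : @ec_embedding P (ECGraph c) f -> forall i j : P, i -- j ->
    f i -- f j /\ c [set f i; f j] = ecol [set i; j].
  by case=> f_inj f_adj f_col i j ij; rewrite f_adj; split=> //; apply: f_col.
have i01 : (inord 0 : 'I_3) != inord 1 by rewrite -val_eqE /= !inordK.
have i02 : (inord 0 : 'I_3) != inord 2 by rewrite -val_eqE /= !inordK.
have i12 : (inord 1 : 'I_3) != inord 2 by rewrite -val_eqE /= !inordK.
move=> P FP f Ef; have {}K3 := K3 P f Ef.
case: FP f Ef K3 => [<-|[<-|[<-|[<-|[]]]]] f Ef K3.
- exact: (@nP3 blue f).
- exact: (@nP3 red f).
- have [a01 /(minor _ _ a01) k01] := K3 _ _ i01.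
  have [a02 /(minor _ _ a02) k02] := K3 _ _ i02.
  have [a12 /(minor _ _ a12) k12] := K3 _ _ i12.
  exact: k12 (k_out _ _ _ a01 a02 k01 k02).
- have ord0E : inord 0 = ord0 :> 'I_3 by apply: val_inj; rewrite /= inordK.
  have [a01 /=] := K3 _ _ i01; rewrite ord0E !inE eqxx => /(major _ _) k01.
  have [a02 /=] := K3 _ _ i02; rewrite ord0E !inE eqxx => /(major _ _) k02.
  have [a12 /=] := K3 _ _ i12; rewrite !inE -!ord0E (negbTE i01) (negbTE i02).
  move/(minor _ _ a12); rewrite ord0E in a01 a02.
  by rewrite -(k01 a01) -(k02 a02).
Qed.

(** * X-augmentations inherit a labelling *)

Section AugmentLabel.
Variables (G0 : sgraph) (T : eqType) (k : G0 -> T).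

(* Preserved by augmentation; it forces [x] and [y] to be isolated from the
   rest of the graph when [k x = k y]. *)
Definition outer_nbrs_labelled (M : seq (G0 * G0)) : Prop :=
  forall x y, (x, y) \in M -> forall v, v \notin [set x; y] ->
    (x -- v -> k v = k x /\ k v <> k y) /\ (y -- v -> k v = k y /\ k v <> k x).

Variables (x y : G0) (B : augment).

(** If [k x = k y], the sides of the augment would share a label without being completely joined;
    the bit tells them apart. *)
Definition augment_label (u : augment_along x y B) : T * bool :=
  match u with
  | inl v => (k (val v), false)
  | inr b => (if b \in augA B then k x else k y,
              (b \notin augA B) && (k x == k y))
  end.

Variable M : seq (kept x y * kept x y).
Hypotheses (k_lab : clique_labelling k)
  (k_outer : outer_nbrs_labelled ((x, y) :: [seq (val p.1, val p.2) | p <- M])).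

Lemma augACP (b : B) : (b \notin augA B) = (b \in augC B).
Proof.
have := in_setT b; rewrite -(aug_cover B) inE.
case bA: (b \in augA B) => //= _.
by rewrite (disjointFr (aug_disj B) bA).
Qed.

Lemma augmented_pair_outer v : v \notin [set x; y] ->
  (x -- v -> k v = k x /\ k v <> k y) /\ (y -- v -> k v = k y /\ k v <> k x).
Proof. by apply: k_outer; rewrite inE eqxx. Qed.

(** An outer neighbour carries the label of its end of the pair and differs from the other end, so
    the bit is [false] here. *)
Lemma cross_adj_label (v : kept x y) (b : B) : cross_adj v b ->
  augment_label (inl v) = augment_label (inr b).
Proof.
have [outx outy] := augmented_pair_outer (valP v).
rewrite /cross_adj /= -augACP; case: (b \in augA B) => /=.
  by rewrite orbF !inE => /andP[_ /outx[-> _]].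
rewrite !inE => /andP[_ /outy[-> nxy]].
by case: eqP => // E; case: nxy.
Qed.

(** Edges between the kept part and the augment never leave a class, so the outer neighbours of a
    vertex lie on its own side of the sum. Inside the augment only two labels occur, so two labels
    different from a third agree. *)
Lemma augment_label_clique_labelling : clique_labelling augment_label.
Proof.
have [k_clique k_out] := k_lab.
have mixed (v : kept x y) (b : B) :
    augment_label (inl v) = augment_label (inr b) -> cross_adj v b.
  have := valP v; rewrite !inE negb_or => /andP[vx vy] /=.
  rewrite /cross_adj -augACP !inE vx vy; case: (b \in augA B) => /= -[kv].
    by rewrite orbF; apply: k_clique; rewrite 1?eq_sym.
  by move=> _; apply: k_clique; rewrite 1?eq_sym.
split=> [[u|a] [v|b] E nuv|[u|a] [v|b] [w|c] //= auv auw kuv kuw].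
- by apply: k_clique; [case: E|apply: contra nuv => /eqP/val_inj->].
- exact: mixed.
- by rewrite sadj_sym; apply: mixed.
- have nab : a != b by apply: contra nuv => /eqP->.
  move: E => /=; case aA: (a \in augA B); case bA: (b \in augA B) => //=.
  + by move=> _; apply: aug_cliqueA.
  + by case=> ->; rewrite eqxx.
  + by case=> ->; rewrite eqxx.
  + by move=> _; apply: (@aug_cliqueC B) => //; rewrite -augACP ?aA ?bA.
- congr (_, _); apply: (k_out (val u)) => // E.
    by apply: kuv; rewrite E.
  by apply: kuw; rewrite E.
- by case: kuw; apply: (cross_adj_label auw).
- by case: kuv; apply: (cross_adj_label auv).
- by case: kuv; apply: (cross_adj_label auv).
- by case: kuv; apply: esym (cross_adj_label auv).
- by case: kuv; apply: esym (cross_adj_label auv).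
- by case: kuw; apply: esym (cross_adj_label auw).
- move: kuv kuw; case: (a \in augA B); case: (b \in augA B);
  by case: (c \in augA B).
Qed.
End AugmentLabel.

(** The other pairs avoid [x] and [y], so both are outer vertices for them; a vertex of the augment
    inherits this from the end it replaces. *)
Lemma augment_label_outer (G0 : sgraph) (T : eqType) (k : G0 -> T) (x y : G0)
    (B : augment) (M : seq (kept x y * kept x y)) :
  outer_nbrs_labelled k ((x, y) :: [seq (val p.1, val p.2) | p <- M]) ->
  outer_nbrs_labelled (@augment_label G0 T k x y B)
    [seq (inl p.1, inl p.2) | p <- M].
Proof.
move=> k_outer p q /mapP[[p' q'] pqM [-> ->]] {p q}.
have pqM' : (val p', val q') \in (x, y) :: [seq (val r.1, val r.2) | r <- M].
  by rewrite inE; apply/orP; right; apply/mapP; exists (p', q').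
have kpq v := k_outer _ _ pqM' v.
have kxpq z : z \in [set x; y] -> z \notin [set val p'; val q'].
  move=> zxy; rewrite !inE; apply/norP; split; apply/eqP=> E.
    by have := valP p'; rewrite -E zxy.
  by have := valP q'; rewrite -E zxy.
pose lab := @augment_label G0 T k x y B.
have cross (p q : kept x y) (b : B) :
    (forall v, v \notin [set val p'; val q'] -> val p -- v ->
      k v <> k (val q)) ->
    cross_adj p b ->
    lab (inr b) = lab (inl p) /\ lab (inr b) <> lab (inl q).
  move=> k_q pb; split; first exact: esym (cross_adj_label k_outer pb).
  move: pb; rewrite /cross_adj -augACP /lab /=.
  case: (b \in augA B) => /=; rewrite ?orbF !inE => /andP[_ pb] -[].
    by apply: k_q; rewrite 1?sadj_sym // kxpq // !inE eqxx.
  by move=> kyq _; case: (k_q y); rewrite 1?sadj_sym // kxpq // !inE eqxx orbT.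
case=> [v|b] /=.
  rewrite !inE => nv.
  have nv' : val v \notin [set val p'; val q'] by rewrite !inE.
  have [outp outq] := kpq _ nv'.
  split=> [/outp|/outq] [-> nE]; split=> // -[] //.
move=> _; split; apply: cross => v /kpq[outp outq].
  by case/outp.
by case/outq.
Qed.

Lemma augmented_labelled (G0 : sgraph) (M : seq (G0 * G0)) (G : sgraph) :
  augmented M G -> forall (T : finType) (k : G0 -> T),
  clique_labelling k -> outer_nbrs_labelled k M -> clique_labelled G.
Proof.
elim=> {G0 M G} [G0 G [f [f_bij f_adj]] T k [k_clique k_out] _|
                 G0 x y B M G _ IH T k k_lab k_outer].
  exists T, (k \o f); split=> [u v /= kuv nuv|u v w /=].
    by rewrite -f_adj; apply: k_clique; rewrite // (inj_eq (bij_inj f_bij)).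
  by rewrite -!f_adj; apply: k_out.
(* Each augmentation adds a bit to the label type, so the induction needs all [T] at once. *)
apply: (IH (T * bool : finType)%type (@augment_label G0 T k x y B)).
  exact: augment_label_clique_labelling k_lab k_outer.
exact: augment_label_outer k_outer.
Qed.

(** The label is the [Y]-end, kept as a singleton to avoid choosing it. Adjacent edges with
    different labels share their [X]-end, where three labels would give three neighbours. *)
Lemma incidence_line_labelling (H : mgraph) (X Y : {set mvertex H}) :
  incidence_mgraph X Y ->
  clique_labelling (fun e : line_graph H => mends e :&: Y).
Proof.
case=> [[XY dXY ends] deg2].
have XNY x : x \in X -> x \in Y -> False.
  by move=> xX; rewrite (disjointFr dXY xX).
have kE (e : medge H) x y : x \in X -> y \in Y -> mends e = [set x; y] ->
    mends e :&: Y = [set y].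
  move=> xX yY ->; apply/setP=> z; rewrite !inE.
  have [->|] := eqVneq z y; first by rewrite orbT yY.
  rewrite orbF; have [->|//] := eqVneq z x.
  by rewrite (disjointFr dXY xX).
split=> [e f /= kef nef|e f g /= ef eg].
  rewrite /line_adj nef; have [x [y [xX yY Ee]]] := ends e.
  apply/set0Pn; exists y.
  have : y \in mends f :&: Y by rewrite -kef (kE e x y) // inE.
  by rewrite Ee !inE eqxx orbT => /andP[].
have share (f' : line_graph H) : e -- f' -> mends e :&: Y <> mends f' :&: Y ->
    exists x y y', [/\ x \in X, y \in Y, y' \in Y, y != y' &
      mends e = [set x; y] /\ mends f' = [set x; y']].
  case/andP=> _ /set0Pn[z]; have [x [y [xX yY Ee]]] := ends e.
  have [x' [y' [xX' yY' Ef]]] := ends f'.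
  rewrite (kE e x y) // (kE f' x' y') // Ee Ef => zef nE.
  have nyy : y != y' by apply/eqP=> E; apply: nE; rewrite E.
  move: zef; rewrite !inE => /andP[/orP[]/eqP-> /orP[]/eqP E].
  - by exists x, y, y'; split=> //; rewrite E.
  - by case: (XNY x) => //; rewrite E.
  - by case: (XNY x') => //; rewrite -E.
  - by rewrite E eqxx in nyy.
move=> /(share f ef)[x [y [y1 [xX yY y1Y nyy1 [Ee Ef]]]]].
move=> /(share g eg)[x' [y' [y2 [xX' yY' y2Y nyy2 [Ee' Eg]]]]].
have Ex : x' = x.
  have : x' \in mends e by rewrite Ee' !inE eqxx.
  rewrite Ee !inE => /orP[]/eqP // E; by case: (XNY x'); rewrite // E.
have Ey : y' = y.
  have : y' \in mends e by rewrite Ee' !inE eqxx orbT.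
  rewrite Ee !inE => /orP[]/eqP // E; by case: (XNY y'); rewrite // E.
subst x' y'; rewrite (kE f x y1) // (kE g x y2) //.
have [-> //|ny12] := eqVneq y1 y2.
have := deg2 x xX; rewrite leqNgt => /negP[].
have sub : [set y; y1; y2] \subset mnbr x.
  apply/subsetP=> z; rewrite !inE => /orP[/orP[]|] /eqP->; apply/existsP.
  - by exists e; rewrite Ee.
  - by exists f; rewrite Ef.
  - by exists g; rewrite Eg.
apply: leq_trans (subset_leq_card sub).
by rewrite -setUA !cardsU1 cards1 !inE negb_or nyy1 nyy2 ny12.
Qed.

Lemma X_augmentation_labelled (G : sgraph) (H : mgraph)
    (X Y : {set mvertex H}) :
  incidence_mgraph X Y -> X_augmentation X G -> clique_labelled G.
Proof.
move=> incH [M [_ flatM commonX augM]].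
have k_lab := incidence_line_labelling incH.
have [k_clique k_out] := k_lab.
have [[XY dXY ends] _] := incH.
have XE (e : medge H) x z : x \in X -> z \in X -> x \in mends e ->
    z \in mends e -> x = z.
  have [x' [y' [xX' yY' ->]]] := ends e.
  move=> xX zX; rewrite !inE => /orP[]/eqP Ex /orP[]/eqP Ez; subst => //;
  by rewrite (disjointFr dXY) in yY'.
apply: (augmented_labelled augM k_lab) => e f efM v.
rewrite !inE negb_or => /andP[nve nvf].
have [ef no_tri] := flatM _ _ efM.
have [x [xX xe xf]] := commonX _ _ efM.
(* By flatness [v] is not adjacent to [e2], so it misses the common [X]-end. It therefore meets [e1]
   in its [Y]-end, and does not have the label of [e2]. *)
have same (e1 e2 : line_graph H) : v != e1 -> v != e2 ->
    (forall z, ~~ ((e1 -- z) && (e2 -- z))) -> x \in mends e1 ->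
    x \in mends e2 -> e1 -- v ->
    mends v :&: Y = mends e1 :&: Y /\ mends v :&: Y <> mends e2 :&: Y.
  move=> n1 n2 no12 x1 x2 av.
  have n2v : ~~ e2 -- v by have := no12 v; rewrite av.
  split; last first.
    by move=> kv; case/negP: n2v; rewrite sadj_sym; apply: k_clique.
  have /andP[_ /set0Pn[z]] := av; rewrite inE => /andP[z1 zv].
  have zX : z \notin X.
    apply/negP=> zX; case/negP: n2v; rewrite /= /line_adj eq_sym n2.
    by apply/set0Pn; exists z; rewrite inE zv (XE e1 z x) ?x2.
  have zY : z \in Y by have := in_setT z; rewrite -XY inE (negbTE zX).
  have yE (h : medge H) : z \in mends h -> mends h :&: Y = [set z].
    have [x' [y' [xX' yY' ->]]] := ends h.
    rewrite !inE => /orP[]/eqP E; first by rewrite E xX' in zX.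
    subst z; apply/setP=> t; rewrite !inE.
    have [->|] := eqVneq t y'; first by rewrite orbT yY'.
    by rewrite orbF; have [->|//] := eqVneq t x'; rewrite (disjointFr dXY xX').
  by rewrite !yE.
split; apply: same => // z.
by rewrite andbC.
Qed.

Lemma incidence_graph_mgraph (H : sgraph) (X Y : {set H}) :
  incidence_graph X Y -> @incidence_mgraph (mgraph_of H) X Y.
Proof.
case=> bip deg2; split=> // x xX; apply: leq_trans (deg2 x xX).
apply/subset_leq_card/subsetP=> y; rewrite !inE.
case/existsP=> -[e e_edge] /= /eqP E.
have := e_edge; rewrite E => /existsP[u /existsP[v /andP[uv /eqP Euv]]].
have : u \in [set x; y] by rewrite Euv !inE eqxx.
have : v \in [set x; y] by rewrite Euv !inE eqxx orbT.
have nuv : u != v by apply: contraTneq uv => ->; rewrite sadj_irr.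
rewrite !inE => /orP[]/eqP Ev /orP[]/eqP Eu; subst => //.
- by rewrite eqxx in nuv.
- by rewrite sadj_sym.
- by rewrite eqxx in nuv.
Qed.

(** * Recognising an augmentation from its contraction *)

Lemma lift_pairs (T : eqType) (P : pred T) (s : seq (T * T)) :
  (forall p, p \in s -> P p.1 && P p.2) ->
  exists s' : seq ({x : T | P x} * {x : T | P x}),
    s = [seq (val p.1, val p.2) | p <- s'].
Proof.
elim: s => [|[x y] s IHs] Ps; first by exists [::].
have [|s' ->] := IHs; first by move=> p ps; apply: Ps; rewrite inE ps orbT.
have /= /andP[Px Py] : P (x, y).1 && P (x, y).2 by apply: Ps; rewrite inE eqxx.
by exists ((exist _ x Px, exist _ y Py) :: s').
Qed.

Lemma matching_cons (T : finType) (x y : T) (M : seq (T * T)) :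
  uniq (map fst ((x, y) :: M) ++ map snd ((x, y) :: M)) ->
  [/\ x != y, uniq (map fst M ++ map snd M)
    & forall u v, (u, v) \in M ->
        (u \notin [set x; y]) && (v \notin [set x; y])].
Proof.
rewrite /= -[y :: _]/([:: y] ++ _) mem_cat -mem_cat uniq_catCA mem_cat.
rewrite -mem_cat /= mem_cat inE !negb_or mem_cat negb_or.
case/andP=> /and3P[xs nxy xs'] /andP[/andP[ys ys'] us]; split=> // u v uvM.
have uM : u \in map fst M by apply/mapP; exists (u, v).
have vM : v \in map snd M by apply/mapP; exists (u, v).
rewrite !inE !negb_or; apply/andP; split; apply/andP; split;
  by [apply: contraNneq xs => <-|apply: contraNneq xs' => <-
     |apply: contraNneq ys => <-|apply: contraNneq ys' => <-].
Qed.

(* [f] collapses each augment of [G] onto the pair of [M] it replaces. *)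
Definition augment_collapse (G0 G : sgraph) (M : seq (G0 * G0)) (f : G -> G0) :
    Prop :=
  [/\ forall e, exists u, f u = e,
      forall u v, f u = f v -> u != v ->
        u -- v /\ f u \in map fst M ++ map snd M,
      forall e e', (e, e') \in M -> exists u v, [/\ u -- v, f u = e & f v = e']
    & forall u v, f u != f v -> (f u, f v) \notin M -> (f v, f u) \notin M ->
        u -- v = f u -- f v].

Section CollapseStep.
Variables (G0 G : sgraph) (x y : G0) (M : seq (kept x y * kept x y)).
Let Mxy := (x, y) :: [seq (val p.1, val p.2) | p <- M].
Variable f : G -> G0.
Hypotheses (M_uniq : uniq (map fst Mxy ++ map snd Mxy))
  (f_col : augment_collapse Mxy f).

Let S := [set u | f u \in [set x; y]].
Let A : {set induced S} := [set u | f (val u) == x].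
Let C : {set induced S} := [set u | f (val u) == y].

Let nxy : x != y. Proof. by have [] := matching_cons M_uniq. Qed.

(** The augment is induced on the preimage of the pair, with the two fibres as its cliques; [g] is
    the inclusion. *)
Lemma collapse_augment : exists B : augment, exists g : B -> G,
  [/\ injective g, forall u v, g u -- g v = u -- v,
      forall u, f u \in [set x; y] -> exists b, g b = u,
      forall b, f (g b) \in [set x; y]
    & forall b, (b \in augA B) = (f (g b) == x)].
Proof.
have [_ f_fib f_edge _] := f_col.
have cover : A :|: C = setT.
  by apply/setP=> u; have := valP u; rewrite !inE.
have disj : [disjoint A & C].
  apply/pred0P=> u; rewrite /= !inE; case: eqP => // ->.
  exact: negbTE.
have cl z : clique [set u : induced S | f (val u) == z].
  move=> u v; rewrite !inE => /eqP fu /eqP fv nuv.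
  by have [] := f_fib (val u) (val v); rewrite ?fu.
have ed : exists a c, [/\ a \in A, c \in C & a -- c].
  have [|u [v [uv fu fv]]] := f_edge x y; first by rewrite inE eqxx.
  have uS : u \in S by rewrite !inE fu eqxx.
  have vS : v \in S by rewrite !inE fv eqxx orbT.
  by exists (exist _ u uS), (exist _ v vS); rewrite !inE /= fu fv !eqxx.
exists (Augment cover disj (cl x) (cl y) ed), val; split=> //.
- exact: val_inj.
- move=> u fu; have uS : u \in S by rewrite inE.
  by exists (exist _ u uS).
- by move=> b; have := valP b; rewrite !inE.
- by move=> b; rewrite inE.
Qed.

(** Undo the collapse over [x] and [y] only: vertices above this pair become vertices of [B], and
    all others keep their image. *)
Lemma collapse_step : exists B : augment,
  let M' : seq (augment_along x y B * augment_along x y B) :=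
    [seq (inl p.1, inl p.2) | p <- M] in
  uniq (map fst M' ++ map snd M') /\
  exists f' : G -> augment_along x y B, augment_collapse M' f'.
Proof.
have [B [g [g_inj g_adj g_sur g_in gA]]] := collapse_augment.
have [f_sur f_fib f_edge f_adj] := f_col.
have gC b : (b \in augC B) = (f (g b) == y).
  rewrite -augACP gA; have := g_in b; rewrite !inE => /orP[]/eqP->.
    by rewrite eqxx (negbTE nxy).
  by rewrite eqxx eq_sym nxy.
(* The refined map [f'] is chosen from its graph [P], so that no proof about [f u] enters its
   definition. *)
pose P u (t : augment_along x y B) : bool :=
  match t with inl v => val v == f u | inr b => g b == u end.
have f'_ex u : exists t, P u t.
  have [fu|fu] := boolP (f u \in [set x; y]).
    by have [b <-] := g_sur u fu; exists (inr b); rewrite /P eqxx.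
  by exists (inl (exist _ (f u) fu)); rewrite /P eqxx.
pose f' u := xchoose (f'_ex u).
have f'P u : P u (f' u) by apply: (xchooseP (f'_ex u)).
have f'g b : f' (g b) = inr b.
  have := f'P (g b); rewrite /P.
  case: (f' (g b)) => [v /eqP E|b' /eqP/g_inj->//].
  by have := valP v; rewrite E g_in.
have f'v u (v : kept x y) : val v = f u -> f' u = inl v.
  move=> E; have := f'P u; rewrite /P; case: (f' u) => [v' /eqP|b /eqP gb].
    by rewrite -E => /val_inj->.
  by have := valP v; rewrite E -gb g_in.
exists B => M'.
have catE : map fst M' ++ map snd M' = map inl (map fst M ++ map snd M).
  by rewrite map_cat -!map_comp.
have valE : map fst [seq (val p.1, val p.2) | p <- M] ++
    map snd [seq (val p.1, val p.2) | p <- M] =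
    map val (map fst M ++ map snd M).
  by rewrite map_cat -!map_comp.
have inl_inj : injective (inl : kept x y -> augment_along x y B).
  by move=> u v [].
split.
  rewrite catE (map_inj_uniq inl_inj) -(map_inj_uniq val_inj) -valE.
  by have [] := matching_cons M_uniq.
have keptE (v : kept x y) : (val v == x) = false /\ (val v == y) = false.
  by have := valP v; rewrite !inE negb_or => /andP[/negbTE-> /negbTE->].
have memM (p q : kept x y) : ((inl p, inl q) \in M') = ((val p, val q) \in Mxy).
  rewrite inE xpair_eqE (keptE p).1 /=.
  rewrite (mem_map (f := fun r => (inl r.1, inl r.2)) _ _ (p, q)).
    by rewrite (mem_map (f := fun r => (val r.1, val r.2)) _ _ (p, q)) // =>
      -[? ?] [? ?] [] /val_inj-> /val_inj->.
  by move=> [? ?] [? ?] [] -> ->.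
exists f'; split.
- case=> [v|b]; last by exists (g b).
  by have [u /esym fu] := f_sur (val v); exists u; apply: f'v.
- move=> u v f'uv nuv; have := f'P u; have := f'P v; rewrite /P f'uv.
  case: (f' v) f'uv => [w|b] f'u /eqP Ev /eqP Eu; last first.
    by rewrite -Ev -Eu eqxx in nuv.
  have [|uv fM] := f_fib u v _ nuv; first by rewrite -Eu -Ev.
  split=> //; rewrite catE (mem_map inl_inj) -(mem_map val_inj) -valE Eu.
  move: fM; rewrite !mem_cat !inE -Eu (keptE w).1.
  by rewrite (keptE w).2.
- move=> e e' /mapP[[p q] pqM [-> ->]].
  have : (val p, val q) \in Mxy by rewrite -memM; apply/mapP; exists (p, q).
  case/f_edge=> u [v [uv fu fv]]; exists u, v; split=> //; exact: f'v.
(* The pairs of [M] avoid [x] and [y], so [(f u, f v)] is no pair in either order and [f] preserves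
   the adjacency of [u] and [v]. *)
have f_xy : forall u v (b : B), g b = v -> f u \notin [set x; y] ->
    u -- v = ((b \in augA B) && (f u \in nbr x :\ y)
      || (b \in augC B) && (f u \in nbr y :\ x)).
  move=> u v b gb nu; have := g_in b; rewrite gA gC gb => fv.
  have nuv : f u != f v by apply: contraNneq nu => ->.
  have /norP[nfx nfy] : ~~ ((f u == x) || (f u == y)) by rewrite !inE in nu.
  have [_ _ M_rest] := matching_cons M_uniq.
  have nM1 : (f u, f v) \notin Mxy.
    rewrite inE xpair_eqE (negbTE nfx) /=.
    by apply/negP=> /M_rest; rewrite fv andbF.
  have nM2 : (f v, f u) \notin Mxy.
    rewrite inE xpair_eqE (negbTE nfy) andbF /=.
    by apply/negP=> /M_rest; rewrite fv.
  rewrite f_adj // sadj_sym !inE nfx nfy.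
  move: fv; rewrite !inE => /orP[]/eqP->.
    by rewrite eqxx (negbTE nxy) orbF.
  by rewrite eqxx eq_sym (negbTE nxy).
move=> u v; have := f'P u; have := f'P v.
case: (f' u) => [p|a]; case: (f' v) => [q|b] /eqP Ev /eqP Eu nuv.
- rewrite !memM Eu Ev /= => nM1 nM2; rewrite Eu Ev f_adj //.
  by rewrite -Eu -Ev; apply: contra nuv => /eqP/val_inj->.
- move=> _ _; rewrite (f_xy u v b) -?Eu //; exact: (valP p).
- move=> _ _; rewrite sadj_sym (f_xy v u a) -?Ev //; exact: (valP q).
- by move=> _ _; rewrite /= -g_adj Eu Ev.
Qed.
End CollapseStep.

(** Without pairs a collapse is an isomorphism; otherwise the first pair is expanded. The induction
    is on the size because the remaining list lives over another graph. *)
Lemma collapse_augmented (G0 G : sgraph) (M : seq (G0 * G0)) (f : G -> G0) :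
  uniq (map fst M ++ map snd M) -> augment_collapse M f -> augmented M G.
Proof.
have [n] := ubnP (size M); elim: n G0 M f => // n IHn G0 [|[x y] M] f.
  move=> _ _ [f_sur f_fib _ f_adj]; apply: augmented_nil; exists f.
  have f_inj : injective f.
    by move=> u v fuv; apply/eqP/negPn/negP=> /(f_fib _ _ fuv)[].
  have g_ex e : exists u, f u == e by have [u <-] := f_sur e; exists u.
  split; first exists (fun e => xchoose (g_ex e)).
  - by move=> u; apply: f_inj; apply/eqP/(xchooseP (g_ex (f u))).
  - by move=> e; apply/eqP/(xchooseP (g_ex e)).
  move=> u v; have [->|nuv] := eqVneq u v; first by rewrite !sadj_irr.
  by rewrite -f_adj // (inj_eq f_inj).
move=> ltn M_uniq f_col.
have [M' EM] : exists M' : seq (kept x y * kept x y),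
    M = [seq (val p.1, val p.2) | p <- M'].
  apply: (lift_pairs (P := fun v => v \notin [set x; y])) => -[u v] uvM /=.
  by have [_ _] := matching_cons M_uniq; apply.
rewrite EM in M_uniq f_col ltn *.
have [B [M'_uniq [f' f'_col]]] := collapse_step M_uniq f_col.
apply: (augmented_cons (B := B)).
apply: (IHn _ _ f') => //; by move: ltn; rewrite /= !size_map.
Qed.

(** * The incidence graph of a labelling *)

Section LabelledIncidence.
Variables (G : sgraph) (T : finType) (k : G -> T).
Hypothesis k_lab : clique_labelling k.

Definition nbr_labels (v : G) : {set T} :=
  [set k w | w in [set w | (w == v) || v -- w]].

Lemma label_in_nbr_labels v : k v \in nbr_labels v.
Proof. by apply/imsetP; exists v; rewrite // inE eqxx. Qed.

Lemma nbr_labels_outer v w : v -- w -> k v != k w ->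
  nbr_labels v = [set k v; k w].
Proof.
move=> vw nvw; apply/setP=> c; rewrite !inE; apply/imsetP/orP.
  case=> z; rewrite inE => /orP[/eqP-> ->|vz ->]; first by left.
  have [->|nvz] := eqVneq (k z) (k v); [by left|right].
  apply/eqP; apply: (k_lab.2 v) => //; last exact/eqP.
  by apply/eqP; rewrite eq_sym.
by case=> /eqP->; [exists v|exists w]; rewrite // inE ?eqxx ?vw ?orbT.
Qed.

Lemma nbr_labels_inner v :
  (forall w, v -- w -> k v = k w) -> nbr_labels v = [set k v].
Proof.
move=> kv; apply/setP=> c; rewrite !inE; apply/imsetP/eqP=> [[z]|->].
  by rewrite inE => /orP[/eqP->|/kv <-].
by exists v; rewrite // inE eqxx.
Qed.

Lemma nbr_labelsP v :
  (exists w, v -- w /\ k v != k w) \/ nbr_labels v = [set k v].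
Proof.
have [/existsP[w /andP[]]|no_w] := boolP [exists w, (v -- w) && (k v != k w)].
  by left; exists w.
right; apply: nbr_labels_inner => w vw; apply/eqP/negPn.
by move/existsPn: no_w => /(_ w); rewrite vw.
Qed.

Lemma card_nbr_labels v : #|nbr_labels v| <= 2.
Proof.
case: (nbr_labelsP v) => [[w [vw nvw]]|->]; last by rewrite cards1.
by rewrite (nbr_labels_outer vw nvw) cards2; case: (_ != _).
Qed.

(* The X-vertex on the edge of [v]: it is shared exactly by the vertices with
   outer neighbours in the same pair of classes, and private when [v] has no
   outer neighbour. *)
Definition block (v : G) : {set T} * option G :=
  (nbr_labels v, if nbr_labels v == [set k v] then Some v else None).

Lemma block_outer v w : v -- w -> k v != k w ->
  block v = ([set k v; k w], None).
Proof.
move=> vw nvw; rewrite /block (nbr_labels_outer vw nvw); case: eqP => // E.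
by have := set22 (k v) (k w); rewrite E inE eq_sym (negbTE nvw).
Qed.

Lemma block_outerC v w : v -- w -> k v != k w -> block v = block w.
Proof.
move=> vw nvw; rewrite (block_outer vw nvw) (@block_outer w v).
- by rewrite setUC.
- by rewrite sadj_sym.
- by rewrite eq_sym.
Qed.

Lemma block_eq u v : block u = block v -> u != v ->
  exists w, [/\ u -- w, k u != k w & k v = k u \/ k v = k w].
Proof.
move=> E nuv; have := E; rewrite /block => -[Es].
case: (nbr_labelsP u) => [[w [uw nuw]] _|Eu].
  exists w; split=> //; have := label_in_nbr_labels v.
  by rewrite -Es (nbr_labels_outer uw nuw) !inE => /orP[]/eqP; auto.
rewrite Eu eqxx; case: ifP => // _ [] E'; by rewrite E' eqxx in nuv.
Qed.

Definition incid_vertex : finType := ({set T} * option G + T)%type.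

(** Each [v] contributes the edge from [block v] to [k v]. Values on the left that are no block
    remain isolated. *)
Definition incid_adj : rel incid_vertex := fun p q =>
  match p, q with
  | inl b, inr c | inr c, inl b => [exists v, (b == block v) && (c == k v)]
  | _, _ => false
  end.

Lemma incid_sym : symmetric incid_adj. Proof. by case=> ? []. Qed.
Lemma incid_irr : irreflexive incid_adj. Proof. by case. Qed.

Definition incid : sgraph := SGraph incid_sym incid_irr.

Definition incidX : {set incid} := [set p | if p is inl _ then true else false].
Definition incidY : {set incid} := [set p | if p is inr _ then true else false].

Lemma incid_incidence_graph : incidence_graph incidX incidY.
Proof.
split; first split.
- by apply/setP=> -[p|p]; rewrite !inE.
- by apply/pred0P=> -[p|p]; rewrite /= !inE.
- case=> e /= /existsP[p /existsP[q /andP[pq /eqP E]]]; rewrite /= E.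
  case: p q pq {E} => [b|c] [b'|c'] //= _.
    by exists (inl b), (inr c'); rewrite !inE.
  by exists (inl b'), (inr c); rewrite !inE setUC.
case=> [b|c]; rewrite inE // => _.
have [/existsP[v /eqP->]|no_v] := boolP [exists v, b == block v].
  (* Every [u] with the block of [v] has the same [nbr_labels], which contains [k u]. *)
  apply: leq_trans (card_nbr_labels v).
  have -> : #|nbr_labels v| = #|inr @: nbr_labels v : {set incid}|.
    by apply/esym/card_imset=> ? ? [].
  apply/subset_leq_card/subsetP=> -[b'|c]; rewrite inE //=.
  case/existsP=> u /andP[/eqP[E _] /eqP->].
  by rewrite mem_imset ?E ?label_in_nbr_labels // => ? ? [].
suff -> : nbr (inl b : incid) = set0 by rewrite cards0.
apply/setP=> -[b'|c]; rewrite !inE //=.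
apply/existsP=> -[v /andP[bv _]]; case/negP: no_v.
by apply/existsP; exists v.
Qed.

Lemma incid_edge_proof v :
  is_edge ([set inl (block v); inr (k v)] : {set incid}).
Proof.
apply/existsP; exists (inl (block v)); apply/existsP; exists (inr (k v)).
by rewrite eqxx andbT; apply/existsP; exists v; rewrite !eqxx.
Qed.

Definition incid_edge (v : G) : line_graph (mgraph_of incid) :=
  exist (fun e : {set incid} => is_edge e) _ (incid_edge_proof v).

Lemma incid_edge_eq u v :
  incid_edge u = incid_edge v <-> block u = block v /\ k u = k v.
Proof.
split=> [/(congr1 val) /= /setP E|[Eb Ek]]; last first.
  by apply: val_inj; rewrite /= Eb Ek.
have := E (inl (block u)); have := E (inr (k u)).
rewrite !inE !eqxx /= orbF => /esym/eqP[Ek] /esym/eqP[Es Eo].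
by split=> //; congr (_, _).
Qed.

Lemma incid_edge_surj e : exists v, incid_edge v = e.
Proof.
case: e => e He; have := He => /existsP[p /existsP[q /andP[pq /eqP E]]].
case: p q pq E => [b|c] [b'|c'] //= /existsP[v /andP[/eqP Eb /eqP Ec]] E.
  by exists v; apply: val_inj; rewrite /= E Eb Ec.
by exists v; apply: val_inj; rewrite /= E Eb Ec setUC.
Qed.

Lemma incid_edge_adj u v : incid_edge u -- incid_edge v =
  (incid_edge u != incid_edge v) && ((block u == block v) || (k u == k v)).
Proof.
rewrite [LHS]/= /line_adj; congr (_ && _); apply/set0Pn/orP => /= [[z]|].
  rewrite !inE => /andP[/orP[]/eqP-> /orP[]/eqP // [E]].
    by move=> E'; left; apply/eqP; congr (_, _).
  by right; rewrite E.
by case=> /eqP->; [exists (inl (block v))|exists (inr (k v))];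
   rewrite !inE !eqxx ?orbT.
Qed.

(* The label order orients each pair, so that it is listed only once. *)
Definition incid_pairs :
    seq (line_graph (mgraph_of incid) * line_graph (mgraph_of incid)) :=
  [seq p <- enum predT |
    [exists u, exists v, [&& u -- v, enum_rank (k u) < enum_rank (k v)
      & p == (incid_edge u, incid_edge v)]]].

Lemma incid_pairsP e f : reflect
  (exists u v, [/\ u -- v, enum_rank (k u) < enum_rank (k v),
                   e = incid_edge u & f = incid_edge v])
  ((e, f) \in incid_pairs).
Proof.
rewrite mem_filter mem_enum andbT.
apply: (iffP existsP) => [[u /existsP[v /and3P[uv lt /eqP[-> ->]]]]|].
  by exists u, v.
case=> u [v [uv lt -> ->]]; exists u; apply/existsP; exists v.
by rewrite uv lt eqxx.
Qed.

Lemma rank_neq (c d : T) : enum_rank c < enum_rank d -> c != d.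
Proof. by move=> lt; apply: contraTneq lt => ->; rewrite ltnn. Qed.

Lemma incid_pairs_uniq :
  uniq (map fst incid_pairs ++ map snd incid_pairs).
Proof.
have pairs_u : uniq incid_pairs by rewrite filter_uniq // enum_uniq.
have set2E (a b c : T) : [set a; b] = [set a; c] -> a != b -> b = c.
  move=> /setP/(_ b); rewrite !inE eqxx orbT => /esym/orP[]/eqP // ->.
  by rewrite eqxx.
(* A pair consists of the two edges at a block with two labels, so one edge determines its
   partner. *)
have same u v u' v' : u -- v -> k u != k v -> u' -- v' -> k u' != k v' ->
    incid_edge u = incid_edge u' -> incid_edge v = incid_edge v' /\ k v = k v'.
  move=> uv nuv uv' nuv' /incid_edge_eq[Eb Ek].
  have Ev : k v = k v'.
    have := Eb; rewrite (block_outer uv nuv) (block_outer uv' nuv') -Ek.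
    by case=> /set2E; apply.
  split=> //; apply/incid_edge_eq; split=> //.
  by rewrite -(block_outerC uv nuv) -(block_outerC uv' nuv').
rewrite cat_uniq; apply/and3P; split.
- rewrite map_inj_in_uniq // => -[e f] [e' f'] /=.
  move=> /incid_pairsP[u [v [uv lt -> ->]]].
  move=> /incid_pairsP[u' [v' [uv' lt' -> ->]]] E.
  have [-> _] := same u v u' v' uv (rank_neq lt) uv' (rank_neq lt') E.
  by rewrite E.
(* An edge in both lists would have the larger label in one pair and the smaller in the other. *)
- apply/hasPn=> e /mapP[[f e'] /incid_pairsP[u [v [uv lt Ef Ee]]] /= E].
  subst; apply/mapP=> -[[e f'] /incid_pairsP[u' [v' [uv' lt' Ee' Ef']]] /= E].
  subst; have [_ Ek] : incid_edge u = incid_edge v' /\ k u = k v'.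
    apply: (same v u u' v'); rewrite ?[k v == _]eq_sym ?rank_neq //.
    by rewrite sadj_sym.
  have [_ Ek'] := (incid_edge_eq v u').1 E.
  by have := ltn_trans lt; rewrite Ek' Ek => /(_ _ lt'); rewrite ltnn.
- rewrite map_inj_in_uniq // => -[e f] [e' f'] /=.
  move=> /incid_pairsP[u [v [uv lt -> ->]]].
  move=> /incid_pairsP[u' [v' [uv' lt' -> ->]]] E.
  have [E' _] : incid_edge u = incid_edge u' /\ k u = k u'.
    by apply: (same v u v' u'); rewrite 1?sadj_sym // eq_sym rank_neq.
  by rewrite E E'.
Qed.

Lemma incid_X_augmentation : @X_augmentation (mgraph_of incid) incidX G.
Proof.
have [k_clique k_out] := k_lab.
have pair_in u v : u -- v -> k u != k v ->
    (incid_edge u, incid_edge v) \in incid_pairs \/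
    (incid_edge v, incid_edge u) \in incid_pairs.
  move=> uv nuv.
  have : (enum_rank (k u) : nat) != enum_rank (k v).
    by rewrite (inj_eq val_inj) (inj_eq enum_rank_inj).
  rewrite neq_ltn => /orP[lt|lt]; [left|right]; apply/incid_pairsP.
    by exists u, v.
  by exists v, u; rewrite sadj_sym.
(* A block shared by distinct vertices is not private, so it has two labels; [v] has the label of
   [u] or lies over the partner edge. *)
have twin u v : block u = block v -> u != v ->
    exists w, [/\ u -- w, k u != k w
                & k v = k u \/ incid_edge v = incid_edge w].
  move=> E nuv; have [w [uw nuw Ek]] := block_eq E nuv.
  exists w; split=> //; case: Ek => Ek; [by left|right].
  by apply/incid_edge_eq; rewrite -E (block_outerC uw nuw).
exists incid_pairs; split.
- split; last exact: incid_pairs_uniq.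
  case=> e f /incid_pairsP[u [v [uv /rank_neq nuv -> ->]]].
  rewrite incid_edge_adj (block_outerC uv nuv) eqxx andbT.
  by apply/eqP=> /incid_edge_eq[_ E]; rewrite E eqxx in nuv.
- move=> e f /incid_pairsP[u [v [uv /rank_neq nuv -> ->]]].
  have Eb := block_outerC uv nuv; split.
    rewrite incid_edge_adj Eb eqxx andbT.
    by apply/eqP=> /incid_edge_eq[_ E]; rewrite E eqxx in nuv.
  move=> z; have [w <-] := incid_edge_surj z; rewrite !incid_edge_adj -Eb.
  apply/negP=> /andP[/andP[nuw buw] /andP[nvw bvw]].
  have {}nuw : block u = block w -> k u = k w -> False.
    by move=> ? ?; case/eqP: nuw; apply/incid_edge_eq.
  have {}nvw : block u = block w -> k v = k w -> False.
    by rewrite Eb => ? ?; case/eqP: nvw; apply/incid_edge_eq.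
  (* A triangle through the block would need a third label there; otherwise [w] would share its
     label with both [u] and [v]. *)
  have [E|nb] := eqVneq (block u) (block w).
    have := label_in_nbr_labels w; have -> : nbr_labels w = nbr_labels u.
      by case: E => ->.
    rewrite (nbr_labels_outer uv nuv) !inE => /orP[]/eqP Ew.
      exact: nuw.
    exact: nvw.
  move: buw bvw; rewrite (negbTE nb) /= => /eqP Euw /eqP Evw.
  by rewrite Euw Evw eqxx in nuv.
- move=> e f /incid_pairsP[u [v [uv /rank_neq nuv -> ->]]].
  exists (inl (block u)); split; rewrite !inE ?eqxx //.
  by rewrite (block_outerC uv nuv) eqxx.
apply: (collapse_augmented (f := incid_edge)); first exact: incid_pairs_uniq.
split.
- exact: incid_edge_surj.
- move=> u v /incid_edge_eq[Eb Ek] nuv; split; first exact: k_clique.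
  have [w [uw nuw _]] := twin u v Eb nuv.
  rewrite mem_cat; apply/orP.
  have [uwM|wuM] := pair_in u w uw nuw; [left|right].
    by apply/mapP; exists (incid_edge u, incid_edge w).
  by apply/mapP; exists (incid_edge w, incid_edge u).
- move=> e f /incid_pairsP[u [v [uv _ -> ->]]].
  by exists u, v.
(* Off the pairs only a common label can cause adjacency: an edge of [G] between classes, or a
   common block with different labels, would yield a pair. *)
move=> u v nuv nM1 nM2; rewrite incid_edge_adj nuv /=.
have nuv' : u != v by apply: contraNneq nuv => ->.
have noM w : u -- w -> k u != k w -> incid_edge v = incid_edge w -> False.
  move=> uw nuw E; have := pair_in u w uw nuw.
  by rewrite -E (negbTE nM1) (negbTE nM2); case.
have [Ek|nk] := eqVneq (k u) (k v); first by rewrite orbT k_clique.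
rewrite orbF; apply/idP/eqP=> [uv|/twin/(_ nuv')[w [uw nuw]]].
  by case: (noM v uv nk).
case=> [E|E]; first by rewrite E eqxx in nk.
by case: (noM w uw nuw E).
Qed.
End LabelledIncidence.

(** * The cycle of equivalences *)

Theorem theorem22 (G : sgraph) :
  [<-> admits_free [:: bP3; rP3; bK3] G;
       admits_free [:: bP3; rP3; rK3] G;
       admits_free [:: bP3; rP3; bK3; rrbK3] G;
       admits_free [:: bP3; rP3; rK3; rbbK3] G;
       exists (H : mgraph) (X Y : {set mvertex H}),
         incidence_mgraph X Y /\ X_augmentation X G;
       exists (H : sgraph) (X Y : {set H}),
         incidence_graph X Y /\ @X_augmentation (mgraph_of H) X G].
Proof.
(* Every implication but one from (6) to (5) passes through [clique_labelled G]; the class colour is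
   red in (1) and (3), blue in (2) and (4). *)
have mixed_mono a :
    admits_free (patterns_mixed a) G -> admits_free (patterns_mono a) G.
  by case=> c c_free; exists c => P FP; apply: c_free; move: FP => /=; tauto.
have labelled_mono a : clique_labelled G -> admits_free (patterns_mono a) G.
  by move=> lab; apply/mixed_mono/labelled_patterns_mixed.
have labelled_graph : clique_labelled G -> exists (H : sgraph) (X Y : {set H}),
    incidence_graph X Y /\ @X_augmentation (mgraph_of H) X G.
  case=> T [k k_lab]; exists (incid k), (incidX k), (incidY k).
  by split; [apply: incid_incidence_graph|apply: incid_X_augmentation].
have graph_labelled : (exists (H : mgraph) (X Y : {set mvertex H}),
    incidence_mgraph X Y /\ X_augmentation X G) -> clique_labelled G.
  by case=> H [X [Y [incH]]]; apply: X_augmentation_labelled incH.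
have mgraph_graph : (exists (H : sgraph) (X Y : {set H}),
    incidence_graph X Y /\ @X_augmentation (mgraph_of H) X G) ->
    exists (H : mgraph) (X Y : {set mvertex H}),
    incidence_mgraph X Y /\ X_augmentation X G.
  case=> H [X [Y [incH augG]]]; exists (mgraph_of H), X, Y.
  by split=> //; apply: incidence_graph_mgraph.
split; [|split; [|split; [|split; [|split]]]].
- by move/(patterns_mono_labelled (a := red)); apply: (labelled_mono blue).
- move/(patterns_mono_labelled (a := blue)).
  exact: (labelled_patterns_mixed red).
- move/(mixed_mono red)/patterns_mono_labelled.
  exact: (labelled_patterns_mixed blue).
- move/(mixed_mono blue)/patterns_mono_labelled => lab.
  exact/mgraph_graph/labelled_graph.
- by move/graph_labelled/labelled_graph.
- by move/mgraph_graph/graph_labelled/(labelled_mono red).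
Qed.
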